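(* Let $G=BH$ be a (unital) transversal decomposition, let $N=\mathrm{core}_G(H)=\bigcap_{g\in G}gHg^{-1}$, and let $B_N=\{xN:x\in B\}\subseteq G/N$. In each of the following items, assertions (i), (ii), (iii) are equivalent. (1) (i) $B^{-1}\subseteq BN$; (ii) $(B_N)^{-1}\subseteq B_N$; (iii) $(B,\cdot)$ satisfies $L_x^{-1}=L_{x^\rho}$ for all $x\in B$ (LIP). (2) (i) $B^2\subseteq BN$; (ii) $(B_N)^2\subseteq B_N$; (iii) $(B,\cdot)$ satisfies $L_xL_x=L_{x\cdot x}$ for all $x\in B$ (LAP). (3) (i) $xBx\subseteq BN$ for all $x\in B$; (ii) $\xi B_N\xi\subseteq B_N$ for all $\xi\in B_N$; (iii) $(B,\cdot)$ is a Bol loop, i.e. $L_xL_yL_x=L_{x\cdot(y\cdot x)}$ for all $x,y\in B$. (4) (i) $xB^2x\subseteq BN$ for all $x\in B$; (ii) $\xi (B_N)^2\xi\subseteq B_N$ for all $\xi\in B_N$; (iii) $(B,\cdot)$ satisfies $L_xL_{y\cdot y}L_x=L_{x\cdot((y\cdot y)\cdot x)}$ for all $x,y\in B$. (5) (i) $xy^2x\in(x\cdot y)^2N$ for all $x,y\in B$; (ii) $\xi\eta^2\xi=(\xi\cdot_N\eta)^2$ for all $\xi,\eta\in B_N$; (iii) $(B,\cdot)$ satisfies $L_xL_yL_yL_x=L_{x\cdot y}L_{x\cdot y}$ for all $x,y\in B$.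
   Context: A (unital) transversal decomposition $G=BH$ means: $G$ is a group with identity $1$, $H$ is a subgroup, $B\subseteq G$ is a left transversal of $H$ (every $g\in G$ is $g=ah$ for unique $a\in B$, $h\in H$), and $B\cap H=\{1\}$. For $x,y\in B$, $x\cdot y$ is the unique element of $B$ with $(x\cdot y)H=xyH$; then $(B,\cdot)$ is a left loop with identity $1$ (each left translation $L_x:B\to B$, $L_xy=x\cdot y$, is a bijection and $1$ is a two-sided identity). $x^\rho\in B$ is the right inverse of $x$ in $(B,\cdot)$: $x\cdot x^\rho=1$. For a subset $S$ of a group, $S^{-1}=\{s^{-1}:s\in S\}$ and $S^2=\{s^2:s\in S\}$ (set of squares in the group); $BN=\{bn:b\in B,n\in N\}$; powers such as $y^2$, $(x\cdot y)^2$ are taken in $G$ (or $G/N$). $G/N=B_N(H/N)$ is again a unital transversal decomposition (with $H/N$ having trivial core in $G/N$), and $\cdot_N$ denotes its induced operation on $B_N$, i.e. $\xi\cdot_N\eta$ is the unique element of $B_N$ with $(\xi\cdot_N\eta)(H/N)=\xi\eta(H/N)$. *)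

(* Defs.v *)
From HB Require Import structures.
From mathcomp Require Import all_boot.
From mathcomp Require Import boolp classical_sets functions.

Set Implicit Arguments.
Unset Strict Implicit.
Unset Printing Implicit Defensive.

Local Open Scope quotient_scope.
Local Open Scope classical_set_scope.
Local Open Scope group_scope.

(* Subgroups of a possibly infinite group are [groupClosed] predicates; under
   the classical axioms boolean-valued predicates represent all subsets. *)

HB.mixin Record isNormalClosed (G : groupType) (S : {pred G}) := {
  normal_closedJ : {in S, forall x g, x ^ g \in S}
}.

#[short(type="normalClosed")]
HB.structure Definition NormalClosed G :=
  {S of isNormalClosed G S & GroupClosed G S}.

Definition lcosetg (G : groupType) (x : G) (A : {pred G}) : set G :=
  [set x * a | a in [set` A]].

Lemma lcosetg_eqP (G : groupType) (H : groupClosed G) (x y : G) :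
  lcosetg x H = lcosetg y H <-> x^-1 * y \in H.
Proof.
split=> [xy|xy].
  have : lcosetg y H y by exists 1; rewrite ?mulg1 //= gpred1.
  by rewrite -xy => -[n nN <-]; rewrite mulKg.
apply/seteqP; split=> z [n /= nN <-].
  exists (y^-1 * x * n); last by rewrite !mulgA mulgV mul1g.
  by rewrite /= gpredMr // -gpredV invgM invgK.
by exists (x^-1 * y * n); [rewrite /= gpredMr|rewrite !mulgA mulgV mul1g].
Qed.

Section CosetGroup.
Variables (G : groupType) (N : normalClosed G).

Definition coset_rel : rel G := fun x y => x^-1 * y \in N.

Fact coset_rel_equiv : equiv_class_of coset_rel.
Proof.
split=> [x|x y|y x z xy yz]; rewrite /coset_rel.
- by rewrite mulVg gpred1.
- by rewrite -gpredV invgM invgK.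
- by have := gpredM _ _ xy yz; rewrite mulgA mulgK.
Qed.

Canonical coset_equiv := EquivRelPack coset_rel_equiv.

(* [coset x] is the element x N of G / N; see [coset_eq_lcosetg]. *)
Definition cosetG : Type := {eq_quot coset_rel}.
HB.instance Definition _ := EqQuotient.on cosetG.
HB.instance Definition _ := Choice.on cosetG.

Definition coset (x : G) : cosetG := \pi_cosetG x.

Lemma coset_eqP x y : reflect (coset x = coset y) (x^-1 * y \in N).
Proof. by rewrite (_ : _ \in N = (coset x == coset y)); [exact: eqP|exact/esym/pi_eq_quot]. Qed.

Lemma coset_reprK X : coset (repr X) = X.
Proof. exact: reprK. Qed.

Lemma coset_eq_lcosetg x y :
  coset x = coset y <-> lcosetg x N = lcosetg y N.
Proof. by rewrite lcosetg_eqP; split=> /coset_eqP. Qed.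

Definition cosetG_one := coset 1.
Definition cosetG_mul (X Y : cosetG) := coset (repr X * repr Y).
Definition cosetG_inv (X : cosetG) := coset (repr X)^-1.

Fact cosetG_mulE x y : cosetG_mul (coset x) (coset y) = coset (x * y).
Proof.
apply/coset_eqP; rewrite invgM !mulgA.
have /coset_eqP := coset_reprK (coset x); set a := repr _ => ax.
have /coset_eqP := coset_reprK (coset y); set b := repr _ => b_y.
have := gpredM _ _ (normal_closedJ _ ax b) b_y.
by rewrite /conjg !mulgA mulgK.
Qed.

Fact cosetG_invE x : cosetG_inv (coset x) = coset x^-1.
Proof.
apply/coset_eqP; rewrite invgK.
have /coset_eqP := coset_reprK (coset x); set a := repr _ => ax.
have := gpredVr _ (normal_closedJ _ ax a^-1).
by rewrite /conjg !(invgM, invgK) !mulgA mulgK.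
Qed.

Fact cosetG_mulA : associative cosetG_mul.
Proof.
move=> X Y Z; rewrite -[X]coset_reprK -[Y]coset_reprK -[Z]coset_reprK.
by rewrite !cosetG_mulE mulgA.
Qed.

Fact cosetG_mul1 : left_id cosetG_one cosetG_mul.
Proof. by move=> X; rewrite -[X]coset_reprK cosetG_mulE mul1g. Qed.

Fact cosetG_1mul : right_id cosetG_one cosetG_mul.
Proof. by move=> X; rewrite -[X]coset_reprK cosetG_mulE mulg1. Qed.

Fact cosetG_mulV : left_inverse cosetG_one cosetG_inv cosetG_mul.
Proof.
by move=> X; rewrite -[X]coset_reprK cosetG_invE cosetG_mulE mulVg.
Qed.

Fact cosetG_Vmul : right_inverse cosetG_one cosetG_inv cosetG_mul.
Proof.
by move=> X; rewrite -[X]coset_reprK cosetG_invE cosetG_mulE mulgV.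
Qed.

HB.instance Definition _ := isGroup.Build cosetG
  cosetG_mulA cosetG_mul1 cosetG_1mul cosetG_mulV cosetG_Vmul.

Lemma cosetM x y : coset (x * y) = coset x * coset y.
Proof. by rewrite -cosetG_mulE. Qed.

Lemma cosetV x : coset x^-1 = (coset x)^-1.
Proof. by rewrite -cosetG_invE. Qed.

(* The image H / N of a subgroup H, as a subgroup of G / N. *)
Definition quotg_pred (H : groupClosed G) : {pred cosetG} :=
  mem [set coset h | h in [set` H]].

Lemma quotg_predP (H : groupClosed G) X :
  reflect (exists2 h, h \in H & coset h = X) (X \in quotg_pred H).
Proof. by apply: (iffP idP); rewrite inE. Qed.

Fact quotg_closed H : group_closed (quotg_pred H).
Proof.
split; first by apply/quotg_predP; exists 1; rewrite ?gpred1.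
move=> _ _ /quotg_predP[h hH <-] /quotg_predP[k kH <-]; apply/quotg_predP.
by exists (h / k); rewrite ?gpredF // cosetM cosetV.
Qed.

HB.instance Definition _ H := isMulClosed.Build cosetG (quotg_pred H)
  (group_closedM (quotg_closed H)).
HB.instance Definition _ H := isMul1Closed.Build cosetG (quotg_pred H)
  (quotg_closed H).1.
HB.instance Definition _ H := isInvClosed.Build cosetG (quotg_pred H)
  (group_closedV (quotg_closed H)).

Definition quotg (H : groupClosed G) : groupClosed cosetG := quotg_pred H.

End CosetGroup.

Section Core.
Variables (G : groupType) (H : groupClosed G).

Definition core_pred : {pred G} :=
  mem (\bigcap_(g in [set: G]) [set g * h * g^-1 | h in [set` H]]).

Lemma core_predP x : reflect (forall g, x ^ g \in H) (x \in core_pred).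
Proof.
apply: (iffP idP) => [|xH]; rewrite inE.
  move=> + g => /(_ g I)[h hH <-].
  by rewrite /conjg !mulgA mulVg mul1g mulgVK.
move=> g _; exists (x ^ g); first exact: xH.
by rewrite /conjg !mulgA mulgV mul1g mulgK.
Qed.

Fact core_closed : group_closed core_pred.
Proof.
split; first by apply/core_predP => g; rewrite conj1g gpred1.
move=> x y /core_predP xH /core_predP yH; apply/core_predP => g.
by rewrite conjMg conjVg gpredF.
Qed.

Fact core_closedJ : {in core_pred, forall x g, x ^ g \in core_pred}.
Proof. by move=> x /core_predP xH g; apply/core_predP => k; rewrite -conjgM. Qed.

HB.instance Definition _ := isMulClosed.Build G core_pred
  (group_closedM core_closed).
HB.instance Definition _ := isMul1Closed.Build G core_pred core_closed.1.
HB.instance Definition _ := isInvClosed.Build G core_pred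
  (group_closedV core_closed).
HB.instance Definition _ := isNormalClosed.Build G core_pred core_closedJ.

Definition core : normalClosed G := core_pred.

Lemma core_sub x : x \in core -> x \in H.
Proof. by move=> /core_predP /(_ 1); rewrite conjg1. Qed.

End Core.

Record transversal_decomposition (G : groupType) (B : set G)
    (H : groupClosed G) : Prop := TransversalDecomposition {
  transversal_factor :
    forall g, exists! ah : G * G, [/\ B ah.1, ah.2 \in H & g = ah.1 * ah.2];
  transversal_unital : B `&` [set` H] = [set 1]
}.

Section LeftLoop.
Variables (G : groupType) (B : set G) (H : groupClosed G).
Hypothesis tBH : transversal_decomposition B H.

Fact transversal1_subproof : 1 \in B.
Proof.
have : [set 1 : G] 1 by [].
by rewrite -(transversal_unital tBH) => -[B1 _]; rewrite inE.
Qed.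

Definition tone : B := exist _ 1 transversal1_subproof.

(* [tone] is only a dummy default: by [tmulP] and [transversal_inj], exactly
   one element of B satisfies the defining equation. *)
Definition tmul (x y : B) : B :=
  xget tone [set z : B | lcosetg (val z) H = lcosetg (val x * val y) H].

Definition ltrans (x : B) : B -> B := tmul x.

Lemma transversal_inj (a b : B) :
  lcosetg (val a) H = lcosetg (val b) H -> a = b.
Proof.
move=> /lcosetg_eqP abH; apply: val_inj.
have [p [_ pu]] := transversal_factor tBH (val b).
have pa : p = (val a, (val a)^-1 * val b).
  by apply: pu; split; rewrite //= ?mulVKg //; exact: set_valP.
have pb : p = (val b, 1).
  by apply: pu; split; rewrite /= ?gpred1 ?mulg1 //; exact: set_valP.
by move: pa; rewrite pb => -[].
Qed.

Lemma transversal_ex (g : G) : exists a : B, lcosetg (val a) H = lcosetg g H.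
Proof.
have [[a h] [[/= aB hH ->] _]] := transversal_factor tBH g.
by exists (exist _ a (mem_set aB)); apply/lcosetg_eqP; rewrite mulKg.
Qed.

Lemma tmulP x y : lcosetg (val (tmul x y)) H = lcosetg (val x * val y) H.
Proof.
by rewrite /tmul; case: xgetP => // /(_ _) /= N;
   have [a /N] := transversal_ex (val x * val y).
Qed.

Lemma ltrans_bij x : bijective (ltrans x).
Proof.
have ltrans_inj : injective (ltrans x).
  move=> y z /(congr1 (fun b : B => lcosetg (val b) H)).
  rewrite !tmulP => /lcosetg_eqP xyz; apply/transversal_inj/lcosetg_eqP.
  by move: xyz; rewrite invgM !mulgA mulgVK.
have /choice[f fK] (y : B) : exists z : B, ltrans x z = y.
  have [a /lcosetg_eqP aH] := transversal_ex ((val x)^-1 * val y).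
  exists a; apply: transversal_inj; rewrite tmulP; apply/lcosetg_eqP.
  by move: aH; rewrite invgM mulgA.
by exists f => // y; apply: ltrans_inj; rewrite fK.
Qed.

HB.instance Definition _ (x : B) := BijTT.Build B B (ltrans x) (ltrans_bij x).

(* The right inverse, i.e. the unique solution y of x . y = 1. *)
Definition trinv (x : B) : B := xget tone [set y | tmul x y = tone].

Lemma trinvP x : tmul x (trinv x) = tone.
Proof.
have [g _ gK] := ltrans_bij x.
by rewrite /trinv; case: xgetP => // /(_ (g tone)) /=; rewrite [tmul _ _]gK.
Qed.

End LeftLoop.

Section Induced.
Variables (G : groupType) (B : set G) (H : groupClosed G).
Hypothesis tBH : transversal_decomposition B H.
Local Notation N := (core H).

Lemma quotg_core x : (coset N x \in quotg N H) = (x \in H).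
Proof.
apply/quotg_predP/idP => [[h hH /coset_eqP/core_sub]|xH]; last by exists x.
by rewrite gpredMl // gpredV.
Qed.

Lemma quot_decomposition :
  transversal_decomposition [set coset N x | x in B] (quotg N H).
Proof.
split.
  move=> X; rewrite -[X]coset_reprK; set g := repr X.
  have [[a h] [[/= aB hH gE] _]] := transversal_factor tBH g.
  exists (coset N a, coset N h); split=> /=.
    by split; [exists a|rewrite quotg_core|rewrite gE cosetM].
  case=> _ K [/= [b bB <-] /quotg_predP[k kH <-]].
  rewrite -cosetM => Ngbk; have ab : a = b.
    pose a' : B := exist _ a (mem_set aB); pose b' : B := exist _ b (mem_set bB).
    suff: a' = b' by case.
    apply: (transversal_inj tBH); apply/lcosetg_eqP => /=.
    move: Ngbk => /coset_eqP/core_sub; rewrite gE invgM -!mulgA.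
    by rewrite gpredMl ?gpredV // mulgA gpredMr.
  congr (_, _); first by rewrite ab.
  by apply: (mulgI (coset N a)); rewrite -!cosetM -gE Ngbk ab.
apply/seteqP; split=> [_ [[b bB <-] /=]|_ ->].
  rewrite quotg_core => bH; suff -> : b = 1 by [].
  by have : [set 1] b by rewrite -(transversal_unital tBH).
split; last by rewrite /= gpred1.
by exists 1 => //; exact/set_mem/(transversal1_subproof tBH).
Qed.

End Induced.

(* Main.v *)
(* G acts on the left cosets of H, hence on B, and the left translation L_x is
   the action of x. The kernel of this action is N, so G / N acts faithfully on
   B; moreover, if g acts as L_b with b in B, then b = g(1). Hence an element g
   lies in BN iff its image in G / N lies in B_N iff g acts as the left
   translation by g(1). Items (1)-(4) are this equivalence for a word g in
   elements of B; item (5) only needs the faithfulness of G / N. *)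
Require Import Defs.
From HB Require Import structures.
From mathcomp Require Import all_boot.
From mathcomp Require Import boolp classical_sets functions.

Local Open Scope classical_set_scope.
Local Open Scope group_scope.

Lemma tfae3 (P Q R : Prop) : (P <-> Q) -> (Q <-> R) -> [<-> P; Q; R].
Proof. by case=> pq qp [qr rq]; tfae; [exact: pq|exact: qr|move=> /rq/qp]. Qed.

Lemma sub_image {T U : Type} (f : T -> U) (A : set T) (C : set U) :
  [set f x | x in A] `<=` C <-> forall x, A x -> C (f x).
Proof. by split=> [sub x Ax|sub _ [x Ax <-]]; apply: sub => //; exists x. Qed.

Lemma iff_forall {T : Type} (P Q : T -> Prop) :
  (forall x, P x <-> Q x) -> (forall x, P x) <-> forall x, Q x.
Proof. by move=> PQ; split=> H x; apply/PQ. Qed.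

Lemma forall_set {T : choiceType} (A : set T) (P : T -> Prop) :
  (forall x, A x -> P x) <-> forall x : A, P (val x).
Proof.
split=> PA x; first by apply: PA; exact: set_valP.
by move=> Ax; exact: (PA (exist _ x (mem_set Ax))).
Qed.

Lemma lcosetg_mul (G : groupType) (H : groupClosed G) (g x y : G) :
  lcosetg x H = lcosetg y H -> lcosetg (g * x) H = lcosetg (g * y) H.
Proof. by rewrite !lcosetg_eqP invgM -mulgA mulKg. Qed.

Section TransversalAction.
Context {G : groupType} {B : set G} {H : groupClosed G}.
Hypothesis tBH : transversal_decomposition B H.
Local Notation N := (core H).
Local Notation one := (tone tBH).

(** The body is that of [tmul] with [val x] replaced by an arbitrary [g], so that [L_x] is the
    action of [x] by conversion. The default [one] is never reached, since [B] meets every left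
    coset of [H]. *)
Definition tact (g : G) (b : B) : B :=
  xget one [set z : B | lcosetg (val z) H = lcosetg (g * val b) H].

Lemma tactP g b : lcosetg (val (tact g b)) H = lcosetg (g * val b) H.
Proof.
rewrite /tact; case: xgetP => // noz.
by have [a /noz] := transversal_ex tBH (g * val b).
Qed.

Lemma ltrans_tact x : ltrans tBH x = tact (val x).
Proof. by []. Qed.

Lemma tact1 : tact 1 = id.
Proof.
by apply/funext => b; apply: (transversal_inj tBH); rewrite tactP mul1g.
Qed.

Lemma tactM g h : tact (g * h) = tact g \o tact h.
Proof.
apply/funext => b; apply: (transversal_inj tBH); rewrite /= !tactP -mulgA.
by apply: lcosetg_mul; rewrite tactP.
Qed.

Lemma tact_val_tone x : tact (val x) one = x.
Proof. by apply: (transversal_inj tBH); rewrite tactP mulg1. Qed.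

(** Agreement of [g] and [h] at [a] in [B] says that the conjugate of [g^-1 * h] by [a] lies in [H].
    An arbitrary conjugator is [a * k] with [k] in [H], and conjugation by [k] preserves [H]; hence
    agreement on [B] puts [g^-1 * h] in the core. *)
Lemma tact_eqP g h : tact g = tact h <-> coset N g = coset N h.
Proof.
split=> [gh|/coset_eqP/core_predP ghN].
  apply/coset_eqP/core_predP => c.
  have [[a k] [[/= aB kH ->] _]] := transversal_factor tBH c.
  pose a' : B := exist _ a (mem_set aB).
  have := tactP g a'; rewrite gh tactP => /esym/lcosetg_eqP /=.
  rewrite invgM => aH; rewrite conjgM [_ ^ k]/conjg gpredMl ?gpredV // gpredMr //.
  by rewrite /conjg !mulgA in aH *.
apply/funext => b; apply: (transversal_inj tBH); rewrite !tactP.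
by apply/lcosetg_eqP; have := ghN (val b); rewrite /conjg invgM !mulgA.
Qed.

Lemma coset_transversalP g :
  [set coset N x | x in B] (coset N g) <-> tact g = ltrans tBH (tact g one).
Proof.
split=> [[x xB /tact_eqP xg]|/tact_eqP gE].
  rewrite -xg ltrans_tact -[x]/(val (exist _ x (mem_set xB) : B)).
  by rewrite tact_val_tone.
by exists (val (tact g one)) => //; exact: set_valP.
Qed.

Lemma mul_coreP x g :
  [set x * n | n in [set` N]] g <-> coset N g = coset N x.
Proof.
split=> [[n nN <-]|/esym/coset_eqP xg]; last by exists (x^-1 * g); rewrite ?mulVKg.
by apply/esym/coset_eqP; rewrite mulKg.
Qed.

Lemma transversal_mul_coreP g :
  [set b * n | b in B & n in [set` N]] g <->
  [set coset N x | x in B] (coset N g).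
Proof.
split=> [[b bB [n nN <-]]|[b bB bg]].
  by exists b => //; apply/coset_eqP; rewrite mulKg.
by have [n nN <-] := (mul_coreP b g).2 (esym bg); exists b => //; exists n.
Qed.

Lemma tact_inv x : tact (val x)^-1 = ((ltrans tBH x)^-1)%FUN.
Proof.
apply/funext => b; have Lb := 'invK_(ltrans tBH x) (in_setT b).
(* Writing [b] as [L_x] of its preimage lets the actions of [x^-1] and [x] cancel. *)
rewrite -[b in LHS]Lb -[LHS]/((tact (val x)^-1 \o tact (val x)) _).
by rewrite -tactM mulVg tact1.
Qed.

(** Acting by [x^-1] on both sides of [tmul x (trinv x) = 1] isolates the right inverse. This is the
    value at 1 needed for the word [x^-1]. *)
Lemma trinv_tact x : trinv tBH x = tact (val x)^-1 one.
Proof.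
have: (tact (val x)^-1 \o tact (val x)) (trinv tBH x) = trinv tBH x.
  by rewrite -tactM mulVg tact1.
by move=> <- /=; rewrite -[tact (val x) _]/(tmul tBH x _) trinvP.
Qed.

Lemma core_wordP (w : G -> G) :
  [set w x | x in B] `<=` [set b * n | b in B & n in [set` N]] <->
  forall x : B, tact (w (val x)) = ltrans tBH (tact (w (val x)) one).
Proof.
rewrite sub_image forall_set; apply: iff_forall => x.
exact: iff_trans (transversal_mul_coreP _) (coset_transversalP _).
Qed.

Lemma quot_wordP (w : G -> G) (wN : cosetG N -> cosetG N)
    (wNE : forall x, wN (coset N x) = coset N (w x)) :
  [set wN X | X in [set coset N x | x in B]] `<=` [set coset N x | x in B] <->
  forall x : B, tact (w (val x)) = ltrans tBH (tact (w (val x)) one).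
Proof.
(* Unfolding the outer image leaves an implication whose premise is again membership in an image;
   folded back into an inclusion, it admits [sub_image] a second time. *)
rewrite sub_image -/(_ `<=` _) sub_image forall_set.
by apply: iff_forall => x; rewrite wNE; exact: coset_transversalP.
Qed.

(** [wN] is the word [w] evaluated in [G / N]. Both inclusions reduce to one condition on the action
    of [w x], so that only its translation into the loop law [P] remains to be supplied. *)
Lemma transversal_word (w : G -> G) (wN : cosetG N -> cosetG N) (P : Prop) :
  (forall x, wN (coset N x) = coset N (w x)) ->
  ((forall x : B, tact (w (val x)) = ltrans tBH (tact (w (val x)) one)) <-> P) ->
  [<-> [set w x | x in B] `<=` [set b * n | b in B & n in [set` N]];
       [set wN X | X in [set coset N x | x in B]]
         `<=` [set coset N x | x in B];
       P].
Proof.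
by move=> wNE wP; apply: tfae3; rewrite (quot_wordP _ _ wNE) // core_wordP.
Qed.

(** With the first variable fixed, this is the one-variable reduction. *)
Lemma transversal_word2 (w : G -> G -> G)
    (wN : cosetG N -> cosetG N -> cosetG N) (P : Prop) :
  (forall x y, wN (coset N x) (coset N y) = coset N (w x y)) ->
  ((forall x y : B, tact (w (val x) (val y)) =
      ltrans tBH (tact (w (val x) (val y)) one)) <-> P) ->
  [<-> forall x, B x ->
         [set w x y | y in B] `<=` [set b * n | b in B & n in [set` N]];
       forall X, [set coset N x | x in B] X ->
         [set wN X Y | Y in [set coset N x | x in B]]
           `<=` [set coset N x | x in B];
       P].
Proof.
move=> wNE wP.
have eq_ii : (forall X, [set coset N x | x in B] X ->
    [set wN X Y | Y in [set coset N x | x in B]]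
      `<=` [set coset N x | x in B]) <->
  forall x y : B, tact (w (val x) (val y)) =
    ltrans tBH (tact (w (val x) (val y)) one).
  rewrite -[X in X <-> _]/(_ `<=` _) sub_image forall_set.
  by apply: iff_forall => x; exact: quot_wordP.
apply: tfae3; rewrite eq_ii // forall_set.
by apply: iff_forall => x; apply: core_wordP.
Qed.

(** The coset equality defining [x . y] passes to [G / N], where representatives in [B_N] are
    unique. [X] and [Y] are constrained only through their values, so that any elements of the
    subtype can be used. *)
Lemma tmul_coset (x y : B) (X Y : [set coset N x | x in B]) :
  val X = coset N (val x) -> val Y = coset N (val y) ->
  val (tmul (quot_decomposition tBH) X Y) = coset N (val (tmul tBH x y)).
Proof.
move=> Xx Yy; have xyB : [set coset N x | x in B] (coset N (val (tmul tBH x y))).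
  by exists (val (tmul tBH x y)) => //; exact: set_valP.
pose Z : [set coset N x | x in B] := SigSub (mem_set xyB).
suff -> : tmul (quot_decomposition tBH) X Y = Z by [].
apply: (transversal_inj (quot_decomposition tBH)).
rewrite tmulP Xx Yy -[val Z]/(coset N (val (tmul tBH x y))).
apply/lcosetg_eqP; set z := val (tmul _ _ _).
have -> : (coset N (val x) * coset N (val y))^-1 * coset N z =
    coset N ((val x * val y)^-1 * z) by rewrite !(cosetM, cosetV).
rewrite quotg_core; exact/lcosetg_eqP/esym/tmulP.
Qed.

End TransversalAction.

Theorem theorem4p2 (G : groupType) (B : set G) (H : groupClosed G)
    (tBH : transversal_decomposition B H) :
  let N := core H in
  let BN := [set b * n | b in B & n in [set` N]] in
  let B_N := [set coset N x | x in B] in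
  let L := ltrans tBH in
  let dot := tmul tBH in
  let dotN := tmul (quot_decomposition tBH) in
  [/\
    [<-> [set x^-1 | x in B] `<=` BN;
         [set xi^-1 | xi in B_N] `<=` B_N;
         forall x : B, ((L x)^-1)%FUN = L (trinv tBH x)],
    [<-> [set x ^+ 2 | x in B] `<=` BN;
         [set xi ^+ 2 | xi in B_N] `<=` B_N;
         forall x : B, L x \o L x = L (dot x x)],
    [<-> forall x, B x -> [set x * y * x | y in B] `<=` BN;
         forall xi, B_N xi -> [set xi * eta * xi | eta in B_N] `<=` B_N;
         forall x y : B, L x \o L y \o L x = L (dot x (dot y x))],
    [<-> forall x, B x -> [set x * y ^+ 2 * x | y in B] `<=` BN;
         forall xi, B_N xi -> [set xi * eta ^+ 2 * xi | eta in B_N] `<=` B_N;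
         forall x y : B,
           L x \o L (dot y y) \o L x = L (dot x (dot (dot y y) x))] &
    [<-> forall x y : B,
           [set (val (dot x y)) ^+ 2 * n | n in [set` N]]
             (val x * val y ^+ 2 * val x);
         forall xi eta : B_N,
           val xi * val eta ^+ 2 * val xi = val (dotN xi eta) ^+ 2;
         forall x y : B,
           L x \o L y \o L y \o L x = L (dot x y) \o L (dot x y)]].
Proof.
move=> N BN B_N L dot dotN.
have tmul1 x : dot x (tone tBH) = x by exact: tact_val_tone.
have tact_tmul x b : tact tBH (val x) b = dot x b by [].
split.
- apply: transversal_word => [x|]; first by rewrite cosetV.
  (* The element [x^-1] acts as the inverse of [L_x] and sends 1 to the right inverse of [x]. *)
  by apply: iff_forall => x; rewrite -trinv_tact tact_inv.
- apply: transversal_word => [x|]; first by rewrite !expgS !expg0 !cosetM.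
  by apply: iff_forall => x; rewrite tactM /= !tact_tmul tmul1.
- apply: transversal_word2 => [x y|]; first by rewrite !cosetM.
  apply: iff_forall => x; apply: iff_forall => y.
  (* The word [x * y * x] acts as [L_x L_y L_x] and sends 1 to [x . (y . x)]. *)
  by rewrite !tactM /= !tact_tmul tmul1.
- apply: transversal_word2 => [x y|]; first by rewrite !cosetM.
  (* Either side, taken at a trivial variable (x = 1, resp. y = 1), yields LAP,
     so that y . y acts on B as y ^+ 2 does. *)
  have sqr_act (y : B) : L (dot y y) = L y \o L y ->
      tact tBH (val y ^+ 2) = L (dot y y).
    by move=> ->; rewrite expgS expg1 tactM.
  split=> [wL x y|lap4 x y].
    have yy : L (dot y y) = L y \o L y.
      have := wL (tone tBH) y.
      rewrite (_ : _ * _ * _ = val y * val y); last first.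
        by rewrite mul1g mulg1 expgS expg1.
      rewrite tactM /= !tact_tmul tmul1.
      exact: esym.
    by have := wL x y; rewrite 2!tactM sqr_act //= !tact_tmul tmul1.
  have yy : L (dot y y) = L y \o L y.
    have := lap4 y (tone tBH).
    rewrite tmul1 -[L (tone tBH)]/(tact tBH 1).
    by rewrite -[dot (tone tBH)]/(tact tBH 1) tact1.
  rewrite 2!tactM sqr_act //=.
  by rewrite !tact_tmul tmul1; exact: lap4.
have wE x y : [set val (dot x y) ^+ 2 * n | n in [set` N]]
      (val x * val y ^+ 2 * val x) <->
    coset N (val x * val y ^+ 2 * val x) = coset N (val (dot x y) ^+ 2).
  exact: mul_coreP.
have sqrN z : coset N z ^+ 2 = coset N (z ^+ 2).
  by rewrite !expgS !expg0 !mulg1 cosetM.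
(* Keeping [X] and [Y] separate from [x] and [y] serves both directions of [eq_ii]: representatives
   are chosen for given cosets, or cosets are formed from given representatives. *)
have wNE (x y : B) (X Y : B_N) :
    val X = coset N (val x) -> val Y = coset N (val y) ->
    val X * val Y ^+ 2 * val X = val (dotN X Y) ^+ 2 <->
    coset N (val x * val y ^+ 2 * val x) = coset N (val (dot x y) ^+ 2).
  move=> Xx Yy; rewrite [val (dotN X Y)](tmul_coset tBH x y X Y Xx Yy) Xx Yy.
  by rewrite !sqrN !cosetM.
have eq_ii : (forall x y : B, coset N (val x * val y ^+ 2 * val x) =
      coset N (val (dot x y) ^+ 2)) <->
    forall X Y : B_N, val X * val Y ^+ 2 * val X = val (dotN X Y) ^+ 2.
  split=> [w X Y|w x y].
    have [x xB xX] := set_valP X; have [y yB yY] := set_valP Y.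
    by apply/(wNE (SigSub (mem_set xB)) (SigSub (mem_set yB))); rewrite ?xX ?yY.
  have cosetB (b : B) : B_N (coset N (val b)).
    by exists (val b) => //; exact: set_valP.
  exact/(wNE x y (SigSub (mem_set (cosetB x))) (SigSub (mem_set (cosetB y)))).
apply: tfae3; rewrite -eq_ii; apply: iff_forall => x; apply: iff_forall => y.
  exact: wE.
(* By faithfulness of the action of [G / N], equality of cosets becomes equality of the two
   composites of left translations. *)
by rewrite -(tact_eqP tBH) !expgS !expg0 !mulg1 !tactM.
Qed.
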